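(* Let $T$ be a tree and let $c'$ be an arbitrary $k$-edge colouring of $T$. Then there is a $k$-vertex colouring $c$ of $T$ which is less symmetric than $c'$.
   Context: Trees may be infinite. A $k$-vertex colouring of $T=(V,E)$ is a function $V\to C$ with $|C|=k$; a $k$-edge colouring is a function $E\to C$ with $|C|=k$. An automorphism $\gamma$ of $T$ preserves a vertex colouring $c$ if $c(\gamma v)=c(v)$ for all vertices $v$ (analogously for edge colourings). The stabiliser of a colouring is the set of automorphisms preserving it, and a colouring $c$ is less symmetric than a colouring $c'$ if the stabiliser of $c$ is contained in the stabiliser of $c'$. *)

(* Defs.v *)
From mathcomp Require Import all_boot.
From mathcomp Require Import boolp classical_sets.

Set Implicit Arguments.
Unset Strict Implicit.
Unset Printing Implicit Defensive.

Local Open Scope classical_set_scope.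

Record graph := Graph {
  vertex : Type;
  edges : set (set vertex);
  edgesP : forall e, edges e -> exists u v, u <> v /\ e = [set u; v] }.

Arguments edges : clear implicits.

Definition adj (G : graph) (u v : vertex G) : Prop := edges G [set u; v].

Definition connected (G : graph) : Prop :=
  forall x y : vertex G, exists (n : nat) (w : nat -> vertex G),
    [/\ w 0 = x, w n = y & forall i, i < n -> adj (w i) (w i.+1)].

(* [ordS] is the successor modulo [n], so [w] lists the distinct vertices of a
   closed walk of length [n]. *)
Definition acyclic (G : graph) : Prop :=
  forall (n : nat) (w : 'I_n -> vertex G),
    2 < n -> injective w -> ~ (forall i, adj (w i) (w (ordS i))).

Definition tree (G : graph) : Prop :=
  [/\ inhabited (vertex G), connected G & acyclic G].

Record aut (G : graph) := Aut {
  aut_fun :> vertex G -> vertex G;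
  aut_bij : bijective aut_fun;
  aut_adj : forall u v, adj (aut_fun u) (aut_fun v) <-> adj u v }.

Lemma aut_edges (G : graph) (g : aut G) (e : set (vertex G)) :
  edges G e -> edges G (g @` e).
Proof.
move=> Ge; have [u [v [_ euv]]] := edgesP Ge.
by rewrite euv image_setU !image_set1; apply/(aut_adj g u v); rewrite /adj -euv.
Qed.

Definition aut_edge (G : graph) (g : aut G) (e : edges G) : edges G :=
  SigSub (mem_set (aut_edges g (set_mem (valP e)))).

(* A possibly infinite cardinal [k] is represented by a type [K] having that
   cardinality. *)
Record colouring (K X : Type) := Colouring {
  palette : Type;
  palette_card : exists f : palette -> K, bijective f;
  colour :> X -> palette }.

Definition vertex_colouring (K : Type) (G : graph) := colouring K (vertex G).
Definition edge_colouring (K : Type) (G : graph) := colouring K (edges G).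

Definition vertex_stab (K : Type) (G : graph) (c : vertex_colouring K G) :
  set (aut G) := [set g | forall v, c (g v) = c v].

Definition edge_stab (K : Type) (G : graph) (c : edge_colouring K G) :
  set (aut G) := [set g | forall e, c (aut_edge g e) = c e].

Definition less_symmetric (K : Type) (G : graph)
    (c : vertex_colouring K G) (c' : edge_colouring K G) : Prop :=
  vertex_stab c `<=` edge_stab c'.

(* Main.v *)
(* Given a nonempty Aut-invariant subtree [A], colour each vertex outside [A]
   with the colour of its edge towards [A]; automorphisms preserving this also
   preserve the colours of the edges not inside [A]. By Zorn's lemma one of two
   things happens. Either some chain of such subtrees has empty intersection:
   then the direction towards the small members of the chain is an invariant
   orientation of all edges, and each vertex gets the colour of its outgoing
   edge. Or there is a minimal [A]: then either [A] has at most one edge, which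
   every automorphism fixes, or every vertex of [A] has two neighbours in [A],
   since removing the leaves would give a smaller invariant subtree. In the
   last case, root [A] at [r] and postpone the colour of an edge at depth [n] to
   all vertices of depth [2n+1]; half of the levels become free and are used to
   make [r] recognisable. *)
Require Import Defs.
From mathcomp Require Import all_boot.
From mathcomp Require Import boolp classical_sets.
From mathcomp Require Import zify.

Set Implicit Arguments.
Unset Strict Implicit.
Unset Printing Implicit Defensive.

Local Open Scope classical_set_scope.

(** * Distances and parents in a rooted tree *)

Section Distance.

Variable T : graph.
Implicit Types u v w x y z r : vertex T.

Lemma adj_sym u v : adj u v -> adj v u.
Proof. by rewrite /adj setUC. Qed.

Lemma adj_irr v : ~ adj v v.
Proof.
rewrite /adj setUid => /edgesP[a [b [ab e]]].
have ha : [set v] a by rewrite e; left.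
have hb : [set v] b by rewrite e; right.
by apply: ab; rewrite ha hb.
Qed.

Fixpoint reach n x y : Prop :=
  if n is m.+1 then exists2 z, adj x z & reach m z y else x = y.

Lemma reach_rcons n x y z : reach n x y -> adj y z -> reach n.+1 x z.
Proof.
elim: n x => [|n IH] x /= => [->|[u xu ru]] yz; first by exists z.
by exists u => //; exact: IH.
Qed.

Lemma reach_sym n x y : reach n x y -> reach n y x.
Proof.
elim: n x => [|n IH] x /= => [->//|[u xu ru]].
by apply: (@reach_rcons n y u); [exact: IH|exact: adj_sym].
Qed.

(** The default 0 for unreachable pairs never arises in a connected graph. *)
Definition dist x y : nat :=
  if pselect (exists n, `[< reach n x y >]) is left h then ex_minn h else 0.

(** The parent of [x] when the tree is rooted at [r]; the root is its own parent. *)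
Definition par r x : vertex T :=
  if pselect (exists z, adj x z /\ dist x r = (dist z r).+1) is left h
  then projT1 (cid h) else x.

Lemma dist_sym x y : dist x y = dist y x.
Proof.
have E n : `[< reach n x y >] = `[< reach n y x >].
  by apply/asboolP/asboolP; exact: reach_sym.
rewrite /dist; case: pselect => h; case: pselect => h' //.
- case: ex_minnP => m mP mm; case: ex_minnP => p pP pm.
  by apply/eqP; rewrite eqn_leq mm ?E // pm // -E.
- by exfalso; apply: h'; case: h => n; rewrite E; exists n.
- by exfalso; apply: h; case: h' => n; rewrite -E; exists n.
Qed.

Lemma aut_reach (g : aut T) n x y : reach n (g x) (g y) <-> reach n x y.
Proof.
have [h gh hg] := aut_bij g.
elim: n x => [|n IH] x /=; first by split=> [/(can_inj gh)|->].
split=> [[z]|[z xz rz]].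
  by rewrite -(hg z) => /aut_adj xz /IH rz; exists (h z).
by exists (g z); [exact/aut_adj|exact/IH].
Qed.

Lemma aut_dist (g : aut T) x y : dist (g x) (g y) = dist x y.
Proof.
have E n : `[< reach n (g x) (g y) >] = `[< reach n x y >].
  by apply/asboolP/asboolP; move/aut_reach.
rewrite /dist; case: pselect => h; case: pselect => h' //.
- case: ex_minnP => m mP mm; case: ex_minnP => p pP pm.
  by apply/eqP; rewrite eqn_leq mm ?E // pm // -E.
- by exfalso; apply: h'; case: h => n; rewrite E; exists n.
- by exfalso; apply: h; case: h' => n; rewrite -E; exists n.
Qed.

Hypothesis hT : tree T.

Lemma dist_reach x y : reach (dist x y) x y.
Proof.
rewrite /dist; case: pselect => [h|[]]; first by case: ex_minnP => m /asboolP.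
have [_ conT _] := hT; have [n [w [<- <- wP]]] := conT x y.
exists n; apply/asboolP; elim: n wP => //= n IH wP.
by apply: (@reach_rcons n _ (w n)); [apply: IH => i /ltnW; exact: wP|exact: wP].
Qed.

Lemma dist_le n x y : reach n x y -> dist x y <= n.
Proof.
move=> /asboolP rn; rewrite /dist; case: pselect => [h|[]]; last by exists n.
by case: ex_minnP => m _; exact.
Qed.

Lemma distxx x : dist x x = 0.
Proof. by apply/eqP; rewrite -leqn0; exact: dist_le. Qed.

Lemma dist_eq0 x y : dist x y = 0 -> x = y.
Proof. by move=> d0; move: (dist_reach x y); rewrite d0. Qed.

Lemma dist_adj r x z : adj x z -> dist x r <= (dist z r).+1.
Proof. by move=> xz; apply: dist_le; exists z => //; exact: dist_reach. Qed.

Lemma parP r x : x <> r -> adj x (par r x) /\ dist x r = (dist (par r x) r).+1.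
Proof.
move=> xr; rewrite /par; case: pselect => [h|[]]; first by case: cid.
have := dist_reach x r; case E : (dist x r) => [|n] /=.
  by move/xr.
case=> z xz zr; exists z; split => //; apply/eqP; rewrite eqSS eqn_leq.
by rewrite dist_le // andbT -ltnS -E dist_adj.
Qed.

Lemma dist_iter_par r k x : k <= dist x r -> dist (iter k (par r) x) r = dist x r - k.
Proof.
elim: k => [|k IH] kx /=; first by rewrite subn0.
have {}IH := IH (ltnW kx).
have /parP[_] : iter k (par r) x <> r by move=> E; move: IH; rewrite E distxx; lia.
by rewrite IH => ?; lia.
Qed.

(** A shortest closed segment of such a walk repeats no vertex. Its length is not 1, as there are no
    loops, nor 2, as the walk never backtracks, so it is a cycle. *)
Lemma no_closed_walk n (w : nat -> vertex T) :
  0 < n -> w 0 = w n -> (forall i, i < n -> adj (w i) (w i.+1)) ->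
  ~ (forall i, i.+2 <= n -> w i <> w i.+2).
Proof.
move=> n0 w0n wadj wnb.
have ex : exists m, `[< 0 < m /\ exists2 i, i + m <= n & w i = w (i + m) >].
  by exists n; apply/asboolP; split => //; exists 0.
case: (ex_minnP ex) => m /asboolP[m0 [i imn wi]] mmin.
have [_ _ acyT] := hT; apply: (acyT m (fun k : 'I_m => w (i + k))).
- case: m m0 imn wi {mmin} => [|[|[|m]]] // _ imn wi.
    by have := wadj i; rewrite addn1 in wi imn; rewrite wi => /(_ imn) /adj_irr.
  by rewrite addn2 in wi imn; case: (wnb i imn).
- have lt_neq (k l : nat) : l < m -> k < l -> w (i + k) <> w (i + l).
    move=> lm kl wkl; suff : m <= l - k by lia.
    apply: mmin; apply/asboolP; split; first lia.
    by exists (i + k); [lia|rewrite wkl; congr w; lia].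
  move=> k l wkl; apply/val_inj => /=; case: (ltngtP k l) => // kl.
    by case: (lt_neq k l (ltn_ord l) kl).
  by case: (lt_neq l k (ltn_ord k) kl).
- move=> k /=; have := ltn_ord k; rewrite leq_eqVlt => /orP[/eqP km|km].
    rewrite km modnn addn0 wi (_ : i + m = (i + k).+1); last by rewrite -addnS km.
    by apply: wadj; lia.
  by rewrite modn_small // addnS; apply: wadj; lia.
Qed.

(** Otherwise descending from [z1] and from [z2] to [r] would close up to a walk through [x] without
    backtracking. Allowing equal distances is what later shows that adjacent vertices are never
    equidistant from [r]. *)
Lemma toward_uniq r x z1 z2 : adj x z1 -> adj x z2 ->
  dist z1 r <= dist x r -> dist z2 r <= dist x r -> z1 = z2.
Proof.
move=> xz1 xz2 d1 d2; apply: contrapT => z12.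
set a := dist z1 r in d1; set b := dist z2 r in d2.
(* The walk climbs from [r] to [z1] at index [a], visits [x] at [a.+1], and descends from [z2] at
   [a.+2] back to [r]. *)
pose w k := if k <= a then iter (a - k) (par r) z1
  else if k == a.+1 then x else iter (k - a.+2) (par r) z2.
have iter_end z : iter (dist z r) (par r) z = r.
  by apply: dist_eq0; rewrite dist_iter_par // subnn.
have wl k : k <= a -> w k = iter (a - k) (par r) z1 by rewrite /w => ->.
have wm : w a.+1 = x by rewrite /w ltnn eqxx.
have wr k : w (a.+2 + k) = iter k (par r) z2.
  rewrite /w !ifF; try (by apply/negbTE; lia); congr iter; lia.
have step z k : k < dist z r ->
    adj (iter k (par r) z) (iter k.+1 (par r) z).
  move=> kz; have [] // := @parP r (iter k (par r) z).
  by move=> E; have := dist_iter_par (ltnW kz); rewrite E distxx; lia.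
apply: (@no_closed_walk (a.+2 + b) w) => //.
- by rewrite wl // subn0 wr !iter_end.
- move=> i ilt; have [ia|ia] := ltnP i a.
    rewrite !wl ?(ltnW ia) //; have -> : a - i = (a - i.+1).+1 by lia.
    by apply/adj_sym/step; lia.
  have [->|ia'] := eqVneq i a; first by rewrite wm wl // subnn; exact: adj_sym.
  have [->|ia''] := eqVneq i a.+1; first by rewrite wm -[a.+2]addn0 wr.
  have -> : i = a.+2 + (i - a.+2) by lia.
  by rewrite -addnS !wr; apply: step; lia.
- move=> i ilt E; have := congr1 (dist^~ r) E => /= {}E'.
  have [ia|ia] := ltnP i.+1 a.
    by move: E'; rewrite !wl ?(ltnW ia, ia) // 2?dist_iter_par; lia.
  have [ia'|ia'] := eqVneq i.+1 a.
    by move: E'; rewrite ia' wm wl 1?dist_iter_par; lia.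
  have [ia''|ia''] := eqVneq i a.
    by move: E; rewrite ia'' -[a.+2]addn0 wr wl // subnn.
  have [ib|ib] := eqVneq i a.+1.
    by move: E'; rewrite ib wm -(addn1 a.+2) wr dist_iter_par; lia.
  have ei : i = a.+2 + (i - a.+2) by lia.
  by move: E'; rewrite ei -!addnS !wr !dist_iter_par; lia.
Qed.

Lemma adj_dist r x z : adj x z ->
  dist x r = (dist z r).+1 \/ dist z r = (dist x r).+1.
Proof.
move=> xz; have := dist_adj r xz; have := dist_adj r (adj_sym xz).
suff : dist x r <> dist z r by lia.
move=> E; have [xr|/parP[xp dx]] := pselect (x = r).
  move: E; rewrite xr distxx => /esym/dist_eq0 zr.
  by move: xz; rewrite xr zr => /adj_irr.
have zp : z = par r x by apply: (@toward_uniq r _ _ _ xz xp); lia.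
by move: dx; rewrite -zp E; lia.
Qed.

Lemma par_eq r x z : adj x z -> dist z r <= dist x r -> par r x = z.
Proof.
move=> xz zx; have /parP[xp dx] : x <> r.
  by move=> E; have := adj_dist r xz; move: zx; rewrite E distxx; lia.
by apply: (@toward_uniq r _ _ _ xp xz); rewrite // dx.
Qed.

Lemma aut_par (g : aut T) r x : x <> r -> par (g r) (g x) = g (par r x).
Proof.
move=> /parP[xp dx]; apply: par_eq; first exact/aut_adj.
by rewrite !aut_dist dx.
Qed.

(* Deleting the edge [vw] leaves two sides; an edge avoiding [v] cannot cross. *)
Lemma same_side v w a a' : adj v w -> adj a a' -> a <> v -> a' <> v ->
  dist w a < dist v a -> dist w a' < dist v a'.
Proof.
move=> vw aa' av a'v wa; rewrite ltnNge; apply/negP => wa'.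
have := adj_dist a vw; have := adj_dist a' vw.
have := adj_dist v aa'; have := adj_dist w aa'.
rewrite !(dist_sym a) !(dist_sym a') => Dw Dv D' D.
have [a'p d'] := parP a'v; set q := par v a' in a'p d'.
have Dq := dist_adj q vw; have Dq' := dist_adj q (adj_sym vw).
rewrite !(dist_sym q) (dist_sym a') in d' Dq Dq'.
(* If the edge crossed, both [a] and [q] would be neighbours of [a'] nearer to [w], hence equal,
   although only [q] is nearer to [v]. *)
have qa : q = a.
  apply: (@toward_uniq w a') => //; first exact: adj_sym.
    by rewrite (dist_sym q) (dist_sym a'); lia.
  by rewrite (dist_sym a) (dist_sym a'); lia.
by move: d'; rewrite qa; lia.
Qed.

(** * Convex sets and invariant subtrees *)

Definition convex (A : set (vertex T)) :=
  forall x y, A x -> A y -> x <> y -> A (par y x).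

(** Walk from [a] to [b] inside [A]: the walk avoids [v], so by [same_side] no step leaves the side
    of the edge at [v] that points to [a]. *)
Lemma convex_par A v a b : convex A -> ~ A v -> A a -> A b -> par a v = par b v.
Proof.
move=> cA nAv Aa Ab; have [n] := ubnP (dist a b).
elim: n a Aa => // n IH a Aa abn.
have [->//|ab] := pselect (a = b).
have [aa' da] := parP ab; have Aa' := cA _ _ Aa Ab ab.
rewrite -(IH _ Aa'); last lia.
have [vw dw] : adj v (par a v) /\ dist v a = (dist (par a v) a).+1.
  by apply: parP => E; rewrite -E in Aa.
apply/esym/par_eq => //; apply/ltnW/(same_side vw aa'); rewrite ?dw //.
- by move=> E; rewrite E in Aa.
- by move=> E; rewrite E in Aa'.
Qed.

Lemma par_convex A r x : convex A -> A r -> A x -> A (par r x).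
Proof.
move=> cA Ar Ax; have [->|xr] := pselect (x = r); last exact: cA.
by rewrite /par; case: pselect => // -[z []]; rewrite distxx.
Qed.

Lemma aut_inv (g : aut T) : exists h : aut T, cancel g h /\ cancel h g.
Proof.
have [h gh hg] := aut_bij g; have hadj u v : adj (h u) (h v) <-> adj u v.
  by rewrite -(aut_adj g) !hg.
by exists (Aut (Bijective hg gh) hadj).
Qed.

Definition invariant_subtree (A : set (vertex T)) :=
  [/\ A !=set0, convex A & forall (g : aut T) v, A v -> A (g v)].

Lemma invariant_subtreeE A (g : aut T) v :
  invariant_subtree A -> A (g v) <-> A v.
Proof.
move=> [_ _ iA]; split; last exact: iA.
by have [h [gh _]] := aut_inv g; move=> /(iA h); rewrite gh.
Qed.

Lemma invariant_subtree_dichotomy :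
  (exists C : set (set (vertex T)), [/\ C `<=` invariant_subtree,
    total_on C subset & forall v, exists2 A, C A & ~ A v]) \/
  (exists2 A, invariant_subtree A &
    forall B, invariant_subtree B -> B `<=` A -> B = A).
Proof.
apply: contrapT => /not_orP[noC]; apply.
(* The order is reverse inclusion, so maximal elements are minimal subtrees and a chain is bounded
   by its intersection, which is nonempty by [noC]. *)
have [||||[A iA] Amin] := @Zorn {A | invariant_subtree A}
  (fun A B => `[< sval B `<=` sval A >]).
- by move=> A; apply/asboolP.
- by move=> B A D /asboolP BA /asboolP DB; apply/asboolP => x /DB /BA.
- move=> [A iA] [B iB] /asboolP /= BA /asboolP /= AB; apply: eq_exist => /=.
  by apply/seteqP.
- move=> C totC; pose D := [set sval A | A in C].
  have iD A : D A -> invariant_subtree A by move=> [[B iB] _ <-].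
  have iI : invariant_subtree (\bigcap_(A in D) A).
    split.
    + apply: contrapT => nI; apply: noC; exists D; split=> //.
        move=> _ _ [A CA <-] [B CB <-].
        by have [/asboolP|/asboolP] := totC A B CA CB; [right|left].
      move=> v; apply: contrapT => nA; apply: nI; exists v => A DA.
      by apply: contrapT => nAv; apply: nA; exists A.
    + move=> x y Ix Iy xy A DA; have [_ cA _] := iD _ DA.
      by apply: cA => //; [exact: Ix|exact: Iy].
    + by move=> g v Iv A DA; have [_ _] := iD _ DA; apply; exact: Iv.
  exists (exist _ _ iI) => A CA; apply/asboolP => /= v; apply.
  by exists A.
- exists A => // B iB BA.
  by have /(_ (asboolT BA)) := Amin (exist _ B iB); case.
Qed.

(** * Vertex colourings built from an edge colouring *)

Section EdgeColour.

Variables (K : Type) (c' : edge_colouring K T) (x0 : palette c').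

(** Extending [c'] by [x0] to all vertex sets avoids carrying proofs of being an edge. *)
Definition ecol (e : set (vertex T)) : palette c' :=
  if pselect (edges T e) is left h then c' (SigSub (mem_set h)) else x0.

Lemma ecolE (e : edges T) : ecol (val e) = c' e.
Proof.
rewrite /ecol; case: pselect => [h|[]]; last exact/set_mem/valP.
by congr (c' _); exact: val_inj.
Qed.

Lemma edge_stabP (g : aut T) :
  (forall u v, adj u v -> ecol [set g u; g v] = ecol [set u; v]) ->
  edge_stab c' g.
Proof.
move=> gE e; rewrite -!ecolE.
have -> : val (aut_edge g e) = g @` val e by [].
have he := set_mem (valP e); have [u [v [_ E]]] := edgesP he.
by move: he; rewrite E => he; rewrite image_setU !image_set1; exact: gE.
Qed.

(** Every edge joins some [v] other than [r] to its parent, because its ends are at different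
    distances from [r]. *)
Lemma edge_stab_par (g : aut T) r :
  (forall v, v <> r ->
    ecol [set g v; g (par r v)] = ecol [set v; par r v]) ->
  edge_stab c' g.
Proof.
move=> gE; apply: edge_stabP.
suff H u v : adj u v -> dist v r <= dist u r ->
    ecol [set g u; g v] = ecol [set u; v].
  move=> u v uv; have [/(H _ _ uv)//|/ltnW vu] := leqP (dist v r) (dist u r).
  by rewrite setUC [in RHS]setUC; apply: H => //; exact: adj_sym.
move=> uv duv; rewrite -(par_eq uv duv); apply: gE => E.
by move: duv (adj_dist r uv); rewrite E distxx; lia.
Qed.

Lemma vertex_colouring_chain (C : set (set (vertex T))) :
  C `<=` invariant_subtree -> total_on C subset ->
  (forall v, exists2 A, C A & ~ A v) ->
  exists c : vertex T -> palette c',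
    forall g : aut T, (forall v, c (g v) = c v) -> edge_stab c' g.
Proof.
move=> iC totC interC.
(* [w] is the next vertex from [v] towards a chain member that misses [v]. Nestedness of the chain
   makes this direction unique. *)
pose up v w := exists A, [/\ C A, ~ A v & forall a, A a -> par a v = w].
have upA A a v : C A -> ~ A v -> A a -> up v (par a v).
  move=> CA Av Aa; exists A; split=> // b Ab.
  by have [_ cA _] := iC _ CA; exact: (convex_par cA).
have up_uniq v w w' : up v w -> up v w' -> w = w'.
  move=> [A [CA Av Aw]] [B [CB Bv Bw]].
  have [[a Aa] _ _] := iC _ CA; have [[b Bb] _ _] := iC _ CB.
  have [AB|BA] := totC _ _ CA CB; first by rewrite -(Aw a) // (Bw a) //; exact: AB.
  by rewrite -(Aw b) ?(Bw b) //; exact: BA.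
have /choice[p pP] : forall v, exists w, up v w.
  move=> v; have [A CA Av] := interC v; have [[a Aa] _ _] := iC _ CA.
  by exists (par a v); exact: (upA A).
exists (fun v => ecol [set v; p v]) => g gc; apply: edge_stabP => u v uv.
(* The smaller of a member missing [u] and a member missing [v] misses both; the end of the edge
   farther from a point of it then points along the edge. *)
have [A [CA Au Av]] : exists A, [/\ C A, ~ A u & ~ A v].
  have [A CA Au] := interC u; have [B CB Bv] := interC v.
  have [AB|BA] := totC _ _ CA CB; first by exists A; split=> // /AB.
  by exists B; split=> // /BA.
have [[a Aa] _ iA] := iC _ CA.
suff H x y : adj x y -> ~ A x -> dist y a <= dist x a ->
    ecol [set g x; g y] = ecol [set x; y].
  have [/(H _ _ uv Au)//|/ltnW vu] := leqP (dist v a) (dist u a).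
  by rewrite setUC [in RHS]setUC; apply: H => //; exact: adj_sym.
move=> xy Ax /(par_eq xy) axy.
have <- : p x = y by apply: (up_uniq x) => //; rewrite -axy; exact: (upA A).
have -> : g (p x) = p (g x); last exact: gc.
apply: (up_uniq (g x)) => //.
have <- : par a x = p x by apply: (up_uniq x) => //; exact: (upA A).
rewrite -aut_par; last by move=> E; rewrite E in Ax.
apply: (upA A) => //; last exact: iA.
by rewrite invariant_subtreeE //; exact: iC.
Qed.

(** Although [g] may move [r], the image stays in [A], and from a vertex outside [A] all of [A] lies
    in one direction. *)
Lemma aut_par_off A (g : aut T) r v : invariant_subtree A -> A r -> ~ A v ->
  g (par r v) = par r (g v).
Proof.
move=> iA Ar Av; rewrite -aut_par; last by move=> E; rewrite E in Av.
have [_ cA gA] := iA; apply: (convex_par cA) => //; last exact: gA.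
by rewrite invariant_subtreeE.
Qed.

Lemma vertex_colouring_small A : invariant_subtree A ->
  (forall v x y, A v -> A x -> A y -> adj v x -> adj v y -> x = y) ->
  exists c : vertex T -> palette c',
    forall g : aut T, (forall v, c (g v) = c v) -> edge_stab c' g.
Proof.
move=> iA A1; have [[r Ar] cA gA] := iA.
(* With a third vertex [x] in [A], the ends [u] and [v] would each be the other's parent towards
   [x]. *)
have A2 u v x : A u -> A v -> adj u v -> A x -> x = u \/ x = v.
  move=> Au Av uv Ax; apply: contrapT => /not_orP[xu xv].
  have [up du] : adj u (par x u) /\ dist u x = (dist (par x u) x).+1.
    by apply: parP => E; exact: xu.
  have [vp dv] : adj v (par x v) /\ dist v x = (dist (par x v) x).+1.
    by apply: parP => E; exact: xv.
  have uE := A1 u _ _ Au (par_convex cA Ax Au) Av up uv.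
  have vE := A1 v _ _ Av (par_convex cA Ax Av) Au vp (adj_sym uv).
  by move: du dv; rewrite uE vE; lia.
exists (fun v => ecol [set v; par r v]) => g gc.
apply: (@edge_stab_par g r) => v vr.
have [Av|Av] := pselect (A v); last by rewrite (aut_par_off g iA).
have [vp _] := parP vr; have Ap := par_convex cA Ar Av.
have gvp : adj (g v) (g (par r v)) by apply/aut_adj.
(* Both the edge and its image consist of all the vertices of [A]. *)
congr ecol; apply/seteqP; split=> x [->|->].
- exact: (A2 v (par r v)) (gA _ _ Av).
- exact: (A2 v (par r v)) (gA _ _ Ap).
- exact: (A2 _ _ _ (gA _ _ Av) (gA _ _ Ap) gvp Av).
- exact: (A2 _ _ _ (gA _ _ Av) (gA _ _ Ap) gvp Ap).
Qed.

(** At most one neighbour of [v] is nearer to [r], so one of any two is farther. *)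
Lemma child A r v :
  (exists x y, [/\ x <> y, A x, A y, adj v x & adj v y]) ->
  exists w, [/\ A w, adj w v & dist w r = (dist v r).+1].
Proof.
move=> [x [y [xy Ax Ay vx vy]]].
have [dx|dx] := adj_dist r vx; last by exists x; split=> //; exact: adj_sym.
have [dy|dy] := adj_dist r vy; last by exists y; split=> //; exact: adj_sym.
by exfalso; apply: xy; apply: (@toward_uniq r _ _ _ vx vy); lia.
Qed.

(* On [A], the vertices at depth at most 1 below [r] get colour [l], those at
   positive even depth get colour [o], and those at depth [2n+1], [n > 0], get
   the colour of the edge above their ancestor at depth [n]. The spare even
   levels make [r] the only vertex of [A] whose closed neighbourhood in [A] is
   coloured by [l], and no information is lost since every vertex of [A] has
   descendants in [A] at all greater depths. *)
Lemma vertex_colouring_leafless A (l o : palette c') : l <> o ->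
  invariant_subtree A ->
  (forall v, A v -> exists x y, [/\ x <> y, A x, A y, adj v x & adj v y]) ->
  exists c : vertex T -> palette c',
    forall g : aut T, (forall v, c (g v) = c v) -> edge_stab c' g.
Proof.
move=> lo iA A2; have [[r Ar] cA gA] := iA.
pose f v := ecol [set v; par r v].
(* From depth [2n+1], the [n+1] parent steps lead to depth [n]. *)
pose c v := if pselect (A v) then
    if dist v r <= 1 then l else
    if odd (dist v r) then f (iter (dist v r)./2.+1 (par r) v) else o
  else f v.
have c_off v : ~ A v -> c v = f v by rewrite /c; case: pselect.
have c_on v : A v -> c v = if dist v r <= 1 then l else
    if odd (dist v r) then f (iter (dist v r)./2.+1 (par r) v) else o.
  by rewrite /c; case: pselect.
have desc k v : A v -> exists x,
    [/\ A x, dist x r = dist v r + k & iter k (par r) x = v].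
  elim: k v => [|k IH] v Av; first by exists v; rewrite addn0.
  have [w [Aw wv dw]] := child r (A2 v Av).
  have [x [Ax dx xw]] := IH w Aw.
  exists x; split=> //=; first by rewrite dx dw addnS.
  by rewrite xw; apply: par_eq; rewrite ?dw.
exists c => g gc.
(* The closed neighbourhood of [g r] in [A] inherits the colour [l] from that of [r]; if [g r]
   differed from [r], it would contain a vertex of positive even depth, coloured [o]. *)
have gr : g r = r.
  apply: contrapT => gr.
  have lN u : A u -> u = g r \/ adj (g r) u -> c u = l.
    have [h [gh hg]] := aut_inv g.
    move=> Au; rewrite -(hg u) gc c_on; last first.
      by apply/(invariant_subtreeE g); rewrite ?hg.
    case=> [|/aut_adj rh]; first by move=> /(can_inj gh) ->; rewrite distxx.
    by have := dist_adj r (adj_sym rh); rewrite distxx => ->.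
  (* Take a child of [g r] if its depth is 1, its parent if the depth is odd and larger, and [g r]
     itself if the depth is even. *)
  have [u [Au gu du ou]] : exists u, [/\ A u, u = g r \/ adj (g r) u,
      1 < dist u r & ~~ odd (dist u r)].
    have Ag := gA g r Ar; have [gp dg] := parP gr.
    have [d1|d1] := eqVneq (dist (g r) r) 1.
      have [w [Aw wg dw]] := child r (A2 _ Ag).
      by exists w; rewrite dw d1; split=> //; right; exact: adj_sym.
    have [og|eg] := boolP (odd (dist (g r) r)).
      exists (par r (g r)); split; [exact: par_convex|by right| |].
        by move: og d1; rewrite dg; case: (dist _ _) => [|[]].
      by move: og; rewrite dg.
    exists (g r); split=> //; first by left.
    by move: eg d1; rewrite dg; case: (dist _ _).
  by apply: lo; rewrite -(lN u) // c_on // leqNgt du (negbTE ou).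
have dg v : dist (g v) r = dist v r by rewrite -{1}gr aut_dist.
have pg v : v <> r -> par r (g v) = g (par r v).
  by move=> vr; rewrite -aut_par // gr.
apply: (@edge_stab_par g r) => v vr; rewrite -pg //.
have [Av|Av] := pselect (A v); last first.
  by have := gc v; rewrite !c_off // invariant_subtreeE.
have [d0|d0] := posnP (dist v r); first by case: vr; exact: dist_eq0.
(* For [v] at depth [d], a descendant [d+1] levels below has depth [2d+1] and so carries the colour
   of the edge above [v]. *)
have [x [Ax dx xv]] := desc (dist v r).+1 v Av.
have itg k : k <= dist x r -> iter k (par r) (g x) = g (iter k (par r) x).
  elim: k => //= k IH kx; rewrite IH ?(ltnW kx) // pg // => E.
  by have := dist_iter_par (ltnW kx); rewrite E distxx; lia.
have dx2 : (dist x r)./2 = dist v r by rewrite dx; lia.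
have ox : odd (dist x r) by rewrite dx; lia.
have x1 : (dist x r <= 1) = false by rewrite dx; lia.
have := gc x; rewrite !c_on //; last exact: gA.
by rewrite dg x1 ox dx2 itg ?xv //; rewrite dx; lia.
Qed.

(** The vertices with two neighbours in [A] form an invariant set, convex because inner vertices of
    paths in [A] qualify. By minimality this set is empty or all of [A]. *)
Lemma minimal_invariant_subtree A : invariant_subtree A ->
  (forall B, invariant_subtree B -> B `<=` A -> B = A) ->
  (forall v x y, A v -> A x -> A y -> adj v x -> adj v y -> x = y) \/
  (forall v, A v -> exists x y, [/\ x <> y, A x, A y, adj v x & adj v y]).
Proof.
move=> [A0 cA gA] Amin.
pose two v := exists x y, [/\ x <> y, A x, A y, adj v x & adj v y].
have [[u [Au u2]]|no2] := pselect (exists u, A u /\ two u); [right|left].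
  suff E : [set v | A v /\ two v] = A by move=> v; rewrite -{1}E => -[].
  apply: Amin; last by move=> v [].
  split; first by exists u.
    move=> x y [Ax x2] [Ay y2] xy; have [xz dx] := parP xy.
    have Az := cA _ _ Ax Ay xy.
    have [->//|zy] := pselect (par y x = y); split=> //.
    have [zw dz] := parP zy.
    exists x, (par y (par y x)); split=> //; last exact: adj_sym.
      by move=> E; move: dx dz; rewrite -E; lia.
    exact: cA.
  move=> g v [Av [x [y [xy Ax Ay vx vy]]]]; split; first exact: gA.
  exists (g x), (g y); split; rewrite ?aut_adj //; [|exact: gA|exact: gA].
  by move=> /(bij_inj (aut_bij g)).
move=> v x y Av Ax Ay vx vy; apply: contrapT => xy.
by apply: no2; exists v; split=> //; exists x, y.
Qed.

End EdgeColour.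

End Distance.

Theorem theorem4 (K : Type) (K_gt0 : inhabited K) (T : graph) (hT : tree T)
    (c' : edge_colouring K T) :
  exists c : vertex_colouring K T, less_symmetric c c'.
Proof.
case: K_gt0 => k0; have [b [b' bK b'K]] := palette_card c'.
suff [c cP] : exists c : vertex T -> palette c',
    forall g : aut T, (forall v, c (g v) = c v) -> edge_stab c' g.
  by exists (Colouring (palette_card c') c) => g; exact: cP.
have x0 := b' k0.
(* With a single colour every automorphism preserves [c'], so a constant colouring will do. *)
have [[l [o lo]]|trivial_palette] :=
    pselect (exists l o : palette c', l <> o); last first.
  exists (fun=> x0) => g _ e; apply: contrapT => ne.
  by apply: trivial_palette; exists (c' (aut_edge g e)), (c' e).
have [[C [iC totC interC]]|[A iA Amin]] := invariant_subtree_dichotomy T.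
  exact: (vertex_colouring_chain hT x0 iC).
have [A1|A2] := minimal_invariant_subtree hT iA Amin.
  exact: (vertex_colouring_small hT x0 iA).
exact: (vertex_colouring_leafless hT x0 lo iA).
Qed.
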